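(* Consider the following algorithm for the transversal matroid secretary problem: set $\mathrm{ALG}\gets\emptyset$, $M\gets\emptyset$, draw $s\sim\mathrm{Bin}(n,p)$; for $i=s+1,\dots,n$: if $r_i\in\mathrm{OPT}(R_i)$ and the vertex $\ell_i:=M_{\mathrm{OPT}(R_i)}(r_i)$ is not covered by $M$, set $\mathrm{ALG}\gets\mathrm{ALG}+r_i$ and $M\gets M\cup\{\ell_ir_i\}$; return $\mathrm{ALG}$. This algorithm has forbidden sets of size $1$, and therefore with $p=1/e$ it is $e$ probability-competitive for transversal matroids.
   Context: Transversal matroid: $G=(L\cup R,F)$ bipartite graph; the matroid $\mathcal{T}[G]$ has ground set $R$ (terminals), $|R|=n$, and $X\subseteq R$ is independent iff some matching of $G$ covers $X$. For every independent $X$ a canonical matching $M_X$ covering $X$ is fixed, not depending on the arrival order; $M_X(r)$ denotes the vertex of $L$ matched to $r$. Ordinal MSP setting: total order $\succ$ on $R$; $\mathrm{OPT}(Q)$ is the greedy (lexicographically maximum w.r.t. $\succ$) base of $Q\subseteq R$, $\mathrm{OPT}=\mathrm{OPT}(R)$; terminals arrive in uniformly random order $r_1,\dots,r_n$ (each revealing its neighbors in $L$), $R_t=\{r_1,\dots,r_t\}$. Probability-competitive: $\Pr(e\in\mathrm{ALG})\ge1/\alpha$ for all $e\in\mathrm{OPT}$. Forbidden sets of size $k$: (1) output always independent; (2) draws $s\sim\mathrm{Bin}(n,p)$ and accepts none of the first $s$ elements; (3) for every $(X,Y,r^* )$ with $Y\subseteq R$, $r^*\in\mathrm{OPT}(Y)$,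 $X\subseteq Y\setminus\{r^*\}$ there is $\mathcal{F}(X,Y,r^* )\subseteq X$ with at most $k$ elements such that for every $t\ge s+1$, if $r_t\in\mathrm{OPT}(R_t)$ and $r_j\notin\mathcal{F}(R_j,R_t,r_t)$ for all $j\in\{s+1,\dots,t-1\}$ then $r_t$ is selected. *)

(* Defs.v *)
From HB Require Import structures.
From mathcomp Require Import all_boot all_order all_algebra.
From mathcomp Require Import all_classical all_reals all_analysis.

Set Implicit Arguments.
Unset Strict Implicit.
Unset Printing Implicit Defensive.

Import Order.TTheory GRing.Theory Num.Theory.

Local Open Scope ring_scope.

(* A bipartite graph on L and T is its edge set F : {set L * T}; T is the set *)
(* of terminals.                                                              *)
Section TransversalMatroid.
Context {L T : finType}.
Implicit Types (F N : {set L * T}) (X : {set T}) (M : {set T} -> {set L * T}).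

Definition is_matching F N : bool :=
  (N \subset F) &&
  [forall e in N, forall f in N, (e != f) ==> (e.1 != f.1) && (e.2 != f.2)].

Definition left_cover N : {set L} := [set e.1 | e in N].
Definition right_cover N : {set T} := [set e.2 | e in N].

Definition transversal_indep F : pred {set T} :=
  fun X => [exists N, is_matching F N && (X \subset right_cover N)].

(* M X is the fixed matching covering X; its values at dependent sets are     *)
(* irrelevant.                                                                *)
Definition canonical_matching F M : Prop :=
  forall X, transversal_indep F X ->
    is_matching F (M X) /\ X \subset right_cover (M X).

Definition partner N (r : T) : option L := [pick l | (l, r) \in N].

End TransversalMatroid.

(* x is preferred to y iff y < x in T, so terminals are scanned in decreasing *)
(* order.                                                                     *)
Definition opt d (T : finOrderType d) (indep : pred {set T}) (Q : {set T}) :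
    {set T} :=
  foldl (fun B x => if indep (x |: B) then x |: B else B)
    finset.set0 (sort >=%O (enum Q)).

(* Arrival orders are bijections r from 'I_n to T. Times are shifted by one:  *)
(* index t stands for time t + 1, so that time >= s + 1 reads s <= t.         *)
Definition arrival_order (T : finType) : Type :=
  {w : {ffun 'I_#|T| -> T} | injectiveb w}.
HB.instance Definition _ (T : finType) := Finite.on (arrival_order T).

Section Arrival.
Context {T : finType}.
Implicit Types (w : arrival_order T) (t : 'I_#|T|).

Definition arrival w t : T := sval w t.
Definition arrived w t : {set T} := [set arrival w j | j : 'I_#|T| & (j <= t)%N].
Definition sample w (s : nat) : {set T} :=
  [set arrival w j | j : 'I_#|T| & (j < s)%N].

End Arrival.

(* The only internal randomness is the sample size; the output is a function  *)
(* of the sample size and of the arrival order.                               *)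
Record sampling_alg (R : realType) (T : finType) := SamplingAlg {
  sample_law : probability nat R ;
  output : nat -> arrival_order T -> {set T} }.

(* Probability of an event depending on the sample size and on a uniformly    *)
(* random arrival order independent of it.                                    *)
Definition Pr (R : realType) (T : finType) (A : sampling_alg R T)
    (E : nat -> arrival_order T -> bool) : \bar R :=
  ((#|{: arrival_order T}|%:R^-1)%:E *
   \sum_(w : arrival_order T) sample_law A [set s | E s w]%classic)%E.

Definition prob_competitive (R : realType) d (T : finOrderType d)
    (indep : pred {set T}) (alpha : R) (A : sampling_alg R T) : Prop :=
  forall e, e \in opt indep [set: T] ->
    ((alpha^-1)%:E <= Pr A (fun s w => e \in output A s w))%E.

Definition has_forbidden_sets (R : realType) d (T : finOrderType d)
    (indep : pred {set T}) (p : R) (k : nat) (A : sampling_alg R T) : Prop :=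
  [/\ forall (s : nat) (w : arrival_order T), (s <= #|T|)%N ->
        indep (output A s w),
      sample_law A = binomial_prob #|T| p :> (set nat -> \bar R) /\
      forall (s : nat) (w : arrival_order T), (s <= #|T|)%N ->
        [disjoint output A s w & sample w s]
    & exists Forb : {set T} -> {set T} -> T -> {set T},
        (forall (X Y : {set T}) (r : T),
           r \in opt indep Y -> X \subset Y :\ r ->
           Forb X Y r \subset X /\ (#|Forb X Y r| <= k)%N) /\
        (forall (s : nat) (w : arrival_order T) (t : 'I_#|T|),
           (s <= #|T|)%N -> (s <= t)%N ->
           arrival w t \in opt indep (arrived w t) ->
           (forall j : 'I_#|T|, (s <= j < t)%N ->
              arrival w j \notin
                Forb (arrived w j) (arrived w t) (arrival w t)) ->
           arrival w t \in output A s w)].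

Section Algorithm.
Context {L : finType} {d : Order.disp_t} {T : finOrderType d}.
Variables (F : {set L * T}) (M : {set T} -> {set L * T}).

Definition alg_step (w : arrival_order T) (st : {set T} * {set L * T})
    (i : 'I_#|T|) : {set T} * {set L * T} :=
  let: (ALG, N) := st in
  let r := arrival w i in
  let O := opt (transversal_indep F) (arrived w i) in
  if r \in O then
    if partner (M O) r is Some l then
      if l \notin left_cover N then (r |: ALG, (l, r) |: N) else st
    else st
  else st.

Definition alg_output (s : nat) (w : arrival_order T) : {set T} :=
  (foldl (alg_step w) (finset.set0, finset.set0) [seq i : 'I_#|T| <- enum 'I_#|T| | (s <= i)%N]).1.

Definition transversal_alg (R : realType) (p : R) : sampling_alg R T :=
  SamplingAlg (binomial_prob #|T| p) alg_output.

End Algorithm.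

(* Main.v *)
(* A terminal r_t of OPT(R_t) is rejected only if its partner l in            *)
(* M_OPT(R_t) was taken by an earlier r_j, and then r_j is the unique         *)
(* terminal that M_OPT(R_j) matches to l: the forbidden set has size 1.       *)
(*                                                                            *)
(* For the ratio, fix e in OPT and the sample size s. If e arrives at time    *)
(* m + 1, then e is in OPT(R_(m+1)); as r_j is uniform in R_j given R_j and   *)
(* all later arrivals, e is accepted with probability at least the product    *)
(* of the 1 - 1 / j for s < j <= m, which is s / m. Averaging over m and over *)
(* s ~ Bin(n, p) gives, with q = 1 - p,                                       *)
(*   q^n / n + p (q + q^2 / 2 + ... + q^(n-1) / (n-1)) >= - p ln p,           *)
(* because E[H_N - H_j] = q + ... + q^N / N for j ~ Bin(N, p) and harmonic    *)
(* sums H. At p = 1 / e the right-hand side is 1 / e.                         *)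
Require Import Defs.
From HB Require Import structures.
From mathcomp Require Import all_boot all_order all_algebra perm ring.

Set Implicit Arguments.
Unset Strict Implicit.
Unset Printing Implicit Defensive.

Import Order.TTheory GRing.Theory Num.Theory.

(** * Transversal matroids and their greedy bases *)

(** The accepted edges always form a matching ([run_matching]), so the output is independent. When a
    terminal of the current greedy base is rejected, its partner was claimed earlier; a matching has
    at most one edge at that vertex, so each earlier prefix has at most one possible culprit
    ([card_rival], [rival_forbidden]).

    For the ratio, matroid augmentation ([matching_augment]) makes greedy bases anti-monotone
    ([opt_anti]): an element of OPT lies in the greedy base of every prefix containing it, so only a
    culprit can stop it. Swapping positions inside a prefix bounds the loss caused by culprits
    ([swap_average], [card_avoid]). The binomial average of the resulting bound has a closed form
    ([binomial_mean_selection_bound]), which [ln_sum_bound] compares with [- (p * ln p)]. *)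

Section Matching.
Context {L T : finType}.
Implicit Types (F N : {set L * T}) (X : {set T}).

Lemma matchingP F N :
  reflect [/\ N \subset F,
              {in N &, injective (fun e : L * T => e.1)} &
              {in N &, injective (fun e : L * T => e.2)}]
          (is_matching F N).
Proof.
apply: (iffP andP) => [[sNF /forall_inP H]|[sNF i1 i2]]; split => //.
- move=> e f eN fN eq1; apply/eqP/negPn/negP => ne.
  by have /forall_inP/(_ _ fN)/implyP/(_ ne)/andP[/eqP] := H _ eN.
- move=> e f eN fN eq2; apply/eqP/negPn/negP => ne.
  by have /forall_inP/(_ _ fN)/implyP/(_ ne)/andP[_ /eqP] := H _ eN.
apply/forall_inP => e eN; apply/forall_inP => f fN; apply/implyP => ne.
by apply/andP; split; apply: contra ne => /eqP;
   [move/(i1 _ _ eN fN)->|move/(i2 _ _ eN fN)->].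
Qed.

Lemma mem_left_cover N l r : (l, r) \in N -> l \in left_cover N.
Proof. by move=> lrN; apply/imsetP; exists (l, r). Qed.

Lemma mem_right_cover N l r : (l, r) \in N -> r \in right_cover N.
Proof. by move=> lrN; apply/imsetP; exists (l, r). Qed.

Lemma sub_matching F N N' : N' \subset N -> is_matching F N -> is_matching F N'.
Proof.
move=> sN /matchingP[sNF i1 i2]; have s x := subsetP sN x.
apply/matchingP; split; first exact: subset_trans sNF.
  by move=> e f /s eN /s fN; apply: i1.
by move=> e f /s eN /s fN; apply: i2.
Qed.

Lemma matchingU1 F N l r : (l, r) \in F -> is_matching F N ->
  l \notin left_cover N -> r \notin right_cover N ->
  is_matching F ((l, r) |: N).
Proof.
move=> lrF /matchingP[sNF i1 i2] lN rN.
apply/matchingP; split.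
- by rewrite subUset sub1set lrF.
- move=> [l1 r1] [l2 r2] /setU1P[->|N1] /setU1P[->|N2] //= ll.
  + by rewrite ll (mem_left_cover N2) in lN.
  + by rewrite -ll (mem_left_cover N1) in lN.
  + exact: i1.
- move=> [l1 r1] [l2 r2] /setU1P[->|N1] /setU1P[->|N2] //= rr.
  + by rewrite rr (mem_right_cover N2) in rN.
  + by rewrite -rr (mem_right_cover N1) in rN.
  + exact: i2.
Qed.

Lemma partnerP F N l r : is_matching F N ->
  reflect (partner N r = Some l) ((l, r) \in N).
Proof.
move=> /matchingP[_ _ i2]; apply: (iffP idP); rewrite /partner; case: pickP.
- by move=> l' l'N lN; have [->] := i2 _ _ l'N lN erefl.
- by move=> /(_ l) ->.
- by move=> l' l'N [<-].
- by [].
Qed.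

(** A matching covering more than [X] can be restricted to its edges ending in [X]. *)
Lemma indepP F X : reflect (exists2 N, is_matching F N & right_cover N = X)
  (transversal_indep F X).
Proof.
apply: (iffP existsP) => [[N /andP[mN sX]]|[N mN <-]]; last first.
  by exists N; rewrite mN subxx.
exists [set e in N | e.2 \in X].
  by apply: sub_matching mN; apply/subsetP => e; rewrite inE => /andP[].
apply/setP => r; apply/imsetP/idP => [[e]|rX].
  by rewrite inE => /andP[_ ?] ->.
have /imsetP[e eN re] := subsetP sX _ rX.
by exists e => //; rewrite inE eN -re.
Qed.

Lemma indep0 F : transversal_indep F set0.
Proof.
apply/indepP; exists set0; last by rewrite /right_cover imset0.
by apply/matchingP; split; rewrite ?sub0set // => e f; rewrite inE.
Qed.

Lemma indep_sub F X X' : X' \subset X ->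
  transversal_indep F X -> transversal_indep F X'.
Proof.
move=> sX /existsP[N /andP[mN sXN]]; apply/existsP; exists N.
by rewrite mN (subset_trans sX).
Qed.

Lemma card_left_cover F N : is_matching F N -> #|left_cover N| = #|N|.
Proof. by move=> /matchingP[_ i1 _]; rewrite card_in_imset. Qed.

Lemma card_right_cover F N : is_matching F N -> #|right_cover N| = #|N|.
Proof. by move=> /matchingP[_ _ i2]; rewrite card_in_imset. Qed.

(* Exchange without alternating paths: an edge (l, r) of N2 with l uncovered  *)
(* by N1 either extends N1, or replaces the edge of N1 at r, which enlarges   *)
(* the intersection of N1 and N2.                                             *)
Lemma matching_augment F N1 N2 : is_matching F N1 -> is_matching F N2 ->
  #|N1| < #|N2| ->
  exists2 x, x \in right_cover N2 :\: right_cover N1 &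
    transversal_indep F (x |: right_cover N1).
Proof.
have [m] := ubnP #|N2 :\: N1|; elim: m N1 => // m IH N1 ltm m1 m2 lt12.
have: ~~ (left_cover N2 \subset left_cover N1).
  apply: contraTN lt12 => /subset_leq_card.
  by rewrite (card_left_cover m1) (card_left_cover m2) -leqNgt.
move=> /subsetPn[l /imsetP[[l0 r] lrN2 /= ->{l}] lN1].
have lrF : (l0, r) \in F by case/matchingP: m2 => /subsetP/(_ _ lrN2).
have [rN1|rN1] := boolP (r \in right_cover N1); last first.
  exists r; first by rewrite inE rN1 (mem_right_cover lrN2).
  apply/existsP; exists ((l0, r) |: N1).
  by rewrite matchingU1 //= /right_cover imsetU1 /=.
have /imsetP[[l' r'] lrN1 /= rr] := rN1; rewrite -{r'}rr in lrN1.
have /matchingP[_ i11 i12] := m1; have /matchingP[_ i21 i22] := m2.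
have ll' : l0 != l' by apply: contraNneq lN1 => ->; exact: mem_left_cover lrN1.
have lr'N2 : (l', r) \notin N2.
  by apply: contra ll' => /(i22 _ _ lrN2)/(_ erefl)[->].
set N' := N1 :\ (l', r).
have sN' : N' \subset N1 by exact: subsetDl.
have rN' : r \notin right_cover N'.
  apply/negP => /imsetP[[a b]] /=; rewrite !inE => /andP[/eqP ne abN1] rb.
  by rewrite -rb in ne abN1; apply: ne; exact: i12.
have lN' : l0 \notin left_cover N'.
  by apply: contra lN1; apply/subsetP; exact: imsetS.
have lrN1' : (l0, r) \notin N1.
  by apply: contra lN1; exact: mem_left_cover.
(* Both the removed and the added edge end at [r], so the covered terminals, and hence the claim, do
   not change. *)
have cov : right_cover ((l0, r) |: N') = right_cover N1.
  by rewrite -(setD1K lrN1) /right_cover !imsetU1.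
rewrite -cov; apply: IH => //.
- apply: leq_trans (proper_card _) ltm; apply/properP; split.
    apply/subsetP => e; rewrite !inE => /andP[+ eN2]; rewrite eN2 andbT.
    apply: contra => eN1; rewrite eN1 andbT.
    by rewrite (contraNneq _ lr'N2) ?orbT // => <-.
  by exists (l0, r); rewrite !inE ?eqxx // lrN1'.
- exact: matchingU1 (sub_matching sN' m1) _ _.
- move: lt12; rewrite (cardsD1 (l', r) N1) lrN1.
  by rewrite cardsU1 inE (negbTE lrN1') andbF.
Qed.

Lemma indep_augment F X Y : transversal_indep F X -> transversal_indep F Y ->
  #|X| < #|Y| -> exists2 x, x \in Y :\: X & transversal_indep F (x |: X).
Proof.
move=> /indepP[N1 m1 <-] /indepP[N2 m2 <-].
rewrite (card_right_cover m1) (card_right_cover m2).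
exact: matching_augment.
Qed.

End Matching.

(** * Greedy bases and their anti-monotonicity *)

Section Greedy.
Context {L : finType} {d : Order.disp_t} {T : finOrderType d}.
Variable F : {set L * T}.
Implicit Types (s : seq T) (B X Y : {set T}).

Local Notation indep := (transversal_indep F).

Let step B x := if indep (x |: B) then x |: B else B.

Lemma greedy_sub B s : B \subset foldl step B s.
Proof.
elim: s B => //= x s IH B; apply: subset_trans (IH _).
by rewrite /step; case: ifP => // _; exact: subsetUr.
Qed.

Lemma greedy_support B s x : x \in foldl step B s -> x \in B \/ x \in s.
Proof.
elim: s B => [|y s IH] B /=; first by left.
rewrite in_cons => /IH[|->]; last by rewrite orbT; right.
rewrite /step; case: ifP => _; last by left.
by case/setU1P => [->|]; [right; rewrite eqxx|left].
Qed.

Lemma greedy_indep B s : indep B -> indep (foldl step B s).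
Proof.
elim: s B => //= x s IH B iB; apply: IH.
by rewrite /step; case: ifP.
Qed.

(** The partial base at the moment [x] is scanned is contained in the final one, so [x] was
    compatible with it and was accepted. *)
Lemma greedy_max B s x : x \in s -> indep (x |: foldl step B s) ->
  x \in foldl step B s.
Proof.
elim: s B => //= y s IH B; rewrite in_cons => /orP[/eqP->|xs]; last exact: IH.
move=> ix; have iy : indep (y |: B).
  apply: indep_sub ix; rewrite setUS //.
  apply: subset_trans (greedy_sub _ s).
  by rewrite /step; case: ifP => // _; exact: subsetUr.
apply: (subsetP (greedy_sub _ s)).
by rewrite /step iy setU11.
Qed.

Lemma greedy_mem s1 s2 x : uniq (s1 ++ x :: s2) ->
  (x \in foldl step set0 (s1 ++ x :: s2)) = indep (x |: foldl step set0 s1).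
Proof.
rewrite cat_uniq /= => /and3P[_ /norP[xs1 _] /andP[xs2 _]].
have xB : x \notin foldl step set0 s1.
  by apply/negP => /greedy_support[]; [rewrite inE|rewrite (negbTE xs1)].
rewrite foldl_cat /= [step _ x]/step; case: ifP => [_|/negbT ix].
  by apply: (subsetP (greedy_sub _ _)); rewrite setU11.
apply/negP => /greedy_support[]; [exact/negP|by rewrite (negbTE xs2)].
Qed.

(* Augmenting the greedy base of s1' from x |: (greedy base of s1) must use x *)
(* eventually, since no independent subset of s1 is larger than its greedy    *)
(* base.                                                                      *)
Lemma greedy_anti s1 s1' x : {subset s1' <= s1} ->
  x \notin s1 -> indep (x |: foldl step set0 s1) ->
  indep (x |: foldl step set0 s1').
Proof.
move=> ss xs1; set B := foldl step set0 s1; set B' := foldl step set0 s1'.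
move=> ixB.
(* A largest set satisfying [P] has more elements than [B], for otherwise [x |: B] would augment it
   within the same bounds. *)
pose P C := [&& indep C, B' \subset C & C \subset B' :|: (x |: B)].
have P0 : P B' by rewrite /P subxx subsetUl greedy_indep // indep0.
case: (arg_maxnP (fun C : {set T} => #|C|) P0) => C /and3P[iC sB'C sC] maxC.
have iB : indep B by apply: greedy_indep; exact: indep0.
have xB : x \notin B.
  by apply/negP => /greedy_support[]; [rewrite inE|rewrite (negbTE xs1)].
have ltC : #|B| < #|C|.
  rewrite ltnNge; apply/negP => leC.
  have [|y] := indep_augment iC ixB.
    by rewrite cardsU1 xB add1n ltnS.
  rewrite inE => /andP[yC yB] iyC.
  have := maxC (y |: C); rewrite /geq /= cardsU1 yC add1n ltnn /P iyC.
  rewrite (subset_trans sB'C (subsetUr _ _)) subUset sC sub1set inE yB orbT.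
  by move=> /(_ isT).
have [y] := indep_augment iB iC ltC.
rewrite inE => /andP[yB yC] iyB.
(* Any other [y] comes from [s1] or [s1'], hence from [s1], and [greedy_max] would put it in [B]. *)
have yx : y = x.
  apply/eqP; apply: contraNT yB => yx; apply: greedy_max iyB.
  have := subsetP sC _ yC; rewrite !inE (negbTE yx) /=.
  move=> /orP[] /greedy_support[]; rewrite ?inE //.
  exact: ss.
by apply: indep_sub iC; rewrite subUset sub1set sB'C -yx yC.
Qed.

Lemma opt_indep X : indep (opt indep X).
Proof. exact: greedy_indep (indep0 F). Qed.

(** Acceptance of [x] depends only on the elements scanned before it, namely those preferred to [x];
    the ones in [X] are among the ones in [Y], so [greedy_anti] applies. *)
Lemma opt_anti X Y x : X \subset Y -> x \in X ->
  x \in opt indep Y -> x \in opt indep X.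
Proof.
move=> sXY xX; have xY := subsetP sXY _ xX.
have sorted_opt (Z : {set T}) z a b : sort >=%O (enum Z) = a ++ z :: b ->
    forall y, (y \in a) = (y \in Z) && (z < y)%O.
  move=> e y.
  have u : uniq (a ++ z :: b) by rewrite -e sort_uniq enum_uniq.
  have : sorted >=%O (a ++ z :: b).
    by rewrite -e; apply: sort_sorted; exact: ge_total.
  have mZ : y \in a ++ z :: b = (y \in Z) by rewrite -e mem_sort mem_enum.
  rewrite -mZ mem_cat in_cons sorted_pairwise; last exact: ge_trans.
  rewrite pairwise_cat /= => /and3P[/allrelP ab _ /andP[/allP zb _]].
  move: u; rewrite cat_uniq /= => /and3P[_ /norP[za _] _].
  have [ya|ya] /= := boolP (y \in a).
    have := ab y z ya; rewrite in_cons eqxx /= => /(_ isT).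
    by rewrite le_eqVlt => /predU1P[zy|//]; rewrite zy ya in za.
  have [->|_] /= := eqVneq y z; first by rewrite ltxx.
  have [yb|//] := boolP (y \in b).
  by apply/esym/negbTE; rewrite -leNgt; exact: zb.
have split (Z : {set T}) : x \in Z ->
    exists a b, sort >=%O (enum Z) = a ++ x :: b.
  move=> xZ; have : x \in sort >=%O (enum Z) by rewrite mem_sort mem_enum.
  by case/splitPr => a b; exists a, b.
have [a [b eY]] := split _ xY; have [a' [b' eX]] := split _ xX.
have uY : uniq (a ++ x :: b) by rewrite -eY sort_uniq enum_uniq.
have uX : uniq (a' ++ x :: b') by rewrite -eX sort_uniq enum_uniq.
rewrite /opt eY eX -!/step !greedy_mem //.
apply: greedy_anti.
  move=> y; rewrite (sorted_opt _ _ _ _ eY) (sorted_opt _ _ _ _ eX).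
  by case/andP=> /(subsetP sXY)-> ->.
by rewrite (sorted_opt _ _ _ _ eY) ltxx andbF.
Qed.

End Greedy.

(** * Forbidden sets *)

Section Arrivals.
Context {T : finType}.
Implicit Types (w : arrival_order T).

Lemma arrival_inj w : injective (arrival w).
Proof. exact/injectiveP/(svalP w). Qed.

Lemma mem_arrived w (i t : 'I_#|T|) : (arrival w i \in arrived w t) = (i <= t).
Proof.
apply/imsetP/idP => [[j + /arrival_inj->]|it]; first by rewrite inE.
by exists i; rewrite ?inE.
Qed.

Lemma mem_sample w (i : 'I_#|T|) s : (arrival w i \in sample w s) = (i < s).
Proof.
apply/imsetP/idP => [[j + /arrival_inj->]|it]; first by rewrite inE.
by exists i; rewrite ?inE.
Qed.

End Arrivals.

Section ForbiddenSets.
Context {L : finType} {d : Order.disp_t} {T : finOrderType d}.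
Variables (F : {set L * T}) (M : {set T} -> {set L * T}).
Hypothesis hM : canonical_matching F M.
Implicit Types (w : arrival_order T) (q : seq 'I_#|T|) (X Y : {set T}).

Local Notation indep := (transversal_indep F).
Local Notation opt := (opt indep).

Definition opt_partner X r : option L := partner (M (opt X)) r.

Lemma canonical_opt_matching X : is_matching F (M (opt X)).
Proof. by have [] := hM (opt_indep F X). Qed.

Lemma opt_partner_edge X r l : opt_partner X r = Some l -> (l, r) \in M (opt X).
Proof. by move/partnerP; apply; exact: canonical_opt_matching. Qed.

Lemma opt_partner_defined X r :
  r \in opt X -> exists l, opt_partner X r = Some l.
Proof.
have [mM sM] := hM (opt_indep F X).
move=> /(subsetP sM)/imsetP[[l r'] lrM /= ->].
by exists l; exact/(partnerP _ _ mM).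
Qed.

Definition run w q := foldl (alg_step F M w) (set0, set0) q.

Lemma run_rcons w q i : run w (rcons q i) = alg_step F M w (run w q) i.
Proof. by rewrite /run -cats1 foldl_cat. Qed.

Lemma alg_step_cases w A N i :
  alg_step F M w (A, N) i = (A, N) \/
  exists l, [/\ arrival w i \in opt (arrived w i),
    opt_partner (arrived w i) (arrival w i) = Some l,
    l \notin left_cover N &
    alg_step F M w (A, N) i = (arrival w i |: A, (l, arrival w i) |: N)].
Proof.
rewrite /alg_step; case: ifP => [rO|_]; last by left.
rewrite -/(opt_partner _ _); case e: opt_partner => [l|]; last by left.
by case: ifP => lN; [right; exists l|left].
Qed.

(** Loop invariant. The last clause records where each edge came from; with [uniq q] it shows that
    the arriving terminal is not yet covered. *)
Lemma run_matching w q : uniq q ->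
  [/\ is_matching F (run w q).2, right_cover (run w q).2 = (run w q).1 &
    forall l r, (l, r) \in (run w q).2 ->
      exists2 j, j \in q & [/\ r = arrival w j,
        r \in opt (arrived w j) & opt_partner (arrived w j) r = Some l]].
Proof.
elim/last_ind: q => [_|q i IH].
  have [N mN rN] := indepP _ _ (indep0 F); split.
  - by apply: sub_matching mN; rewrite sub0set.
  - by rewrite /right_cover imset0.
  - by move=> l r; rewrite inE.
rewrite rcons_uniq run_rcons => /andP[iq /IH{IH}].
case: (run w q) => A N [mN rN edgeN]; rewrite /= in mN rN edgeN.
case: (alg_step_cases w A N i) => [->|[l [rO pl lN ->]]] /=.
  split=> // l r /edgeN[j jq H]; exists j => //.
  by rewrite mem_rcons in_cons jq orbT.
split.
- apply: matchingU1 => //.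
    have /matchingP[/subsetP sMF _ _] := canonical_opt_matching (arrived w i).
    exact/sMF/opt_partner_edge.
  apply/imsetP => -[[l' r'] /edgeN[j jq [-> _ _]]] /= /arrival_inj ij.
  by rewrite ij jq in iq.
- by rewrite -rN /right_cover imsetU1.
- move=> l' r' /setU1P[[-> ->]|/edgeN[j jq H]].
    by exists i; rewrite ?mem_rcons ?in_cons ?eqxx.
  by exists j => //; rewrite mem_rcons in_cons jq orbT.
Qed.

Lemma run_sub w q q' : (run w q).1 \subset (run w (q ++ q')).1.
Proof.
elim/last_ind: q' => [|q' i IH]; first by rewrite cats0.
rewrite -rcons_cat run_rcons; apply: subset_trans IH _.
case: (run w (q ++ q')) => A N.
case: (alg_step_cases w A N i) => [->|[l [_ _ _ ->]]] //=.
exact: subsetUr.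
Qed.

Definition rounds (s : nat) : seq 'I_#|T| :=
  [seq i : 'I_#|T| <- enum 'I_#|T| | s <= i].

Lemma rounds_uniq s : uniq (rounds s).
Proof. by rewrite filter_uniq ?enum_uniq. Qed.

Lemma mem_rounds s (i : 'I_#|T|) : (i \in rounds s) = (s <= i).
Proof. by rewrite mem_filter mem_enum andbT. Qed.

Lemma rounds_split s (t : 'I_#|T|) : s <= t -> exists q q',
  rounds s = rcons q t ++ q' /\ {in q, forall j : 'I_#|T|, s <= j < t}.
Proof.
rewrite -mem_rounds => ts.
have [q [q' eq_rounds]] : exists q q', rounds s = q ++ t :: q'.
  by case/splitPr: ts => q q'; exists q, q'.
have : sorted (fun i j : 'I_#|T| => i < j) (rounds s).
  apply: sorted_filter => [? ? ?|]; first exact: ltn_trans.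
  by have := iota_ltn_sorted 0 #|T|; rewrite -val_enum_ord sorted_map.
rewrite sorted_pairwise; last by move=> ? ? ?; exact: ltn_trans.
rewrite eq_rounds pairwise_cat => /andP[/allrelP lt _].
exists q, q'; split=> [|j jq]; first by rewrite cat_rcons.
by rewrite -mem_rounds eq_rounds mem_cat jq /=; apply: lt; rewrite ?mem_head.
Qed.

Lemma alg_outputE s w : alg_output F M s w = (run w (rounds s)).1.
Proof. by []. Qed.

Lemma alg_output_indep s w : indep (alg_output F M s w).
Proof.
have [mN rN _] := run_matching w (rounds_uniq s).
by apply/indepP; exists (run w (rounds s)).2.
Qed.

Lemma alg_output_sample s w : [disjoint alg_output F M s w & sample w s].
Proof.
have [_ rN edge] := run_matching w (rounds_uniq s).
rewrite disjoint_subset; apply/subsetP => x.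
rewrite alg_outputE -rN => /imsetP[[l r] /edge[j + [-> _ _]] /= ->].
by rewrite inE mem_sample mem_rounds -leqNgt.
Qed.

(* The canonical partner of r in OPT(Y) can only have been taken by the       *)
(* terminal of X that M_OPT(X) matches to that same vertex of L.              *)
Definition rival X Y r : {set T} :=
  [set x in X | (x \in opt X) && (opt_partner X x == opt_partner Y r)].

Lemma rival_sub X Y r : rival X Y r \subset X.
Proof. by apply/subsetP => x; rewrite inE => /andP[]. Qed.

(** Since [r] is in the base, its partner is a genuine vertex [l] and not [None]; two rivals would
    give two edges of [M (opt X)] at [l]. *)
Lemma card_rival X Y r : r \in opt Y -> #|rival X Y r| <= 1.
Proof.
move=> /opt_partner_defined[l e]; apply/card_le1_eqP => x y.
rewrite !inE e => /and3P[_ _ /eqP/opt_partner_edge lx].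
move=> /and3P[_ _ /eqP/opt_partner_edge ly].
have /matchingP[_ i1 _] := canonical_opt_matching X.
by case: (i1 _ _ lx ly erefl).
Qed.

Lemma rival_forbidden s w (t : 'I_#|T|) :
  s <= t -> arrival w t \in opt (arrived w t) ->
  (forall j : 'I_#|T|, s <= j < t ->
    arrival w j \notin rival (arrived w j) (arrived w t) (arrival w t)) ->
  arrival w t \in alg_output F M s w.
Proof.
move=> st tO free; have [q [q' [eq_rounds q_lt]]] := rounds_split st.
rewrite alg_outputE eq_rounds; apply: (subsetP (run_sub _ _ _)).
have uq : uniq q.
  by have := rounds_uniq s; rewrite eq_rounds cat_uniq rcons_uniq -andbA;
     case/and3P.
rewrite run_rcons; have [_ _ edge] := run_matching w uq.
case: (run w q) edge => A N /= edge; rewrite tO.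
have [l e] := opt_partner_defined tO.
rewrite -/(opt_partner _ _) e; case: ifP => [_|/negbT]; first exact: setU11.
(* If the partner is covered, the edge covering it was added at some time [j] in [q], and that
   terminal is a rival, against [free]. *)
rewrite negbK => /imsetP[[l' r] /edge[j jq [-> jO pj]] /= ll'].
have := free j (q_lt j jq); rewrite inE mem_arrived leqnn jO pj e -ll'.
by rewrite eqxx.
Qed.

End ForbiddenSets.

(** * Uniformly random arrival orders *)

Section Reorder.
Context {T : finType}.
Implicit Types (w : arrival_order T) (i j k t : 'I_#|T|).

Lemma reorder_subproof w (u : {perm 'I_#|T|}) :
  injectiveb [ffun i => arrival w (u i)].
Proof.
by apply/injectiveP => i j; rewrite !ffunE => /arrival_inj/perm_inj.
Qed.

Definition reorder w u : arrival_order T :=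
  exist (fun v : {ffun 'I_#|T| -> T} => injectiveb v) _ (reorder_subproof w u).

Lemma arrival_reorder w u i : arrival (reorder w u) i = arrival w (u i).
Proof. by rewrite /arrival /= ffunE. Qed.

Lemma arrival_ext w w' : arrival w =1 arrival w' -> w = w'.
Proof. by move=> e; apply/val_inj/ffunP. Qed.

Lemma arrival_surj w x : exists i, arrival w i = x.
Proof.
have [|g _ gK] := inj_card_bij (@arrival_inj _ w); first by rewrite card_ord.
by exists (g x).
Qed.

Definition swap w j k := reorder w (tperm k j).

Lemma swapK j k : involutive (swap^~ j ^~ k).
Proof.
by move=> w; apply: arrival_ext => i; rewrite !arrival_reorder tpermK.
Qed.

Lemma arrival_swap w j k i : k <= j < i -> arrival (swap w j k) i = arrival w i.
Proof.
move=> /andP[kj ji]; rewrite arrival_reorder tpermD //; last first.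
  by rewrite -val_eqE ltn_eqF.
by rewrite -val_eqE ltn_eqF // (leq_ltn_trans kj).
Qed.

Lemma arrived_swap w j k i :
  k <= j <= i -> arrived (swap w j k) i = arrived w i.
Proof.
move=> /andP[kj ji]; apply/setP => x; have [l <-] := arrival_surj w x.
rewrite -[l in LHS](tpermK k j) -arrival_reorder !mem_arrived.
case: tpermP => [->|->|//]; by rewrite ?ji ?(leq_trans kj).
Qed.

(* Exchanging the terminals at times k and j is a measure-preserving          *)
(* involution; summing over k in P turns the event at time j into an average. *)
Lemma swap_average (G : {set arrival_order T}) (P : pred 'I_#|T|)
    (A : arrival_order T -> 'I_#|T| -> bool) j :
  (forall w k, P k -> w \in G -> swap w j k \in G) ->
  (forall w k, P k -> w \in G -> A (swap w j k) j = A w k) ->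
  #|P| * #|[set w in G | A w j]| = \sum_(w in G) #|[pred k | P k && A w k]|.
Proof.
move=> swapG swapA.
transitivity (\sum_(w in G) \sum_(k | P k) A w k); last first.
  by apply: eq_bigr => w _; rewrite -[RHS]sum1_card big_mkcondr.
rewrite exchange_big /= -sum_nat_const; apply: eq_bigr => k Pk.
rewrite (reindex_inj (inv_inj (swapK j k))) /= -[LHS]sum1_card big_mkcond /=.
rewrite [RHS]big_mkcond /=; apply: eq_bigr => w _.
have -> : (swap w j k \in G) = (w \in G).
  apply/idP/idP; last exact: swapG.
  by move/(swapG _ _ Pk); rewrite swapK.
rewrite inE; case wG: (w \in G) => //=.
by rewrite -(swapA (swap w j k)) ?swapG // swapK; case: (A w j).
Qed.

(** * Counting the orders that avoid the forbidden sets *)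

Section AvoidForbidden.
Variables (f : {set T} -> {set T} -> {set T}) (e : T).
Hypothesis card_f : forall X Y : {set T}, e \in Y -> #|f X Y| <= 1.

Definition avoid t s : {set arrival_order T} :=
  [set w | (arrival w t == e) && [forall j : 'I_#|T|, (s <= j < t) ==>
     (arrival w j \notin f (arrived w j) (arrived w t))]].

Lemma avoidP w t s : reflect (arrival w t = e /\
    forall j, s <= j < t -> arrival w j \notin f (arrived w j) (arrived w t))
  (w \in avoid t s).
Proof.
rewrite inE; apply: (iffP andP) => [[/eqP-> /forallP H]|[-> H]].
  by split=> // j; apply/implyP.
by split=> //; apply/forallP => j; apply/implyP/H.
Qed.

Lemma avoid_self t w : (w \in avoid t t) = (arrival w t == e).
Proof.
apply/avoidP/eqP => [[]//|wt]; split=> // j /andP[tj /(leq_ltn_trans tj)].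
by rewrite ltnn.
Qed.

(** Averaging over swaps of [t] with every position: each order has exactly one position holding
    [e]. *)
Lemma card_avoid_self t : #|T| * #|avoid t t| = #|{: arrival_order T}|.
Proof.
transitivity (#|{: 'I_#|T|}| *
  #|[set w in [set: arrival_order T] | arrival w t == e]|).
  by rewrite card_ord; congr (_ * _); apply: eq_card => w;
     rewrite avoid_self !inE.
rewrite (@swap_average _ _ (fun w k => arrival w k == e)) => [|w k _ _|w k _ _].
- rewrite -[RHS]sum1_card; apply: eq_big => [w|w _]; first by rewrite inE.
  have [i wi] := arrival_surj w e; rewrite (@eq_card1 _ i) // => k.
  by rewrite !inE -wi (inj_eq (@arrival_inj _ w)).
- by rewrite inE.
- by rewrite arrival_reorder tpermR.
Qed.

(** Swapping [j] with some [k <= j] changes neither the terminals after [j] nor the sets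
    [arrived w i] for [i >= j]. So, within [avoid t j.+1], the terminal at [j] is uniform over
    [j.+1] positions, of which at most one holds a forbidden terminal: at most a fraction [1 / j.+1]
    is lost. *)
Lemma card_avoidS t (j : 'I_#|T|) : j < t ->
  j * #|avoid t j.+1| <= j.+1 * #|avoid t j|.
Proof.
move=> jt.
set bad := fun w (k : 'I_#|T|) =>
  arrival w k \in f (arrived w j) (arrived w t).
have avoidE w : (w \in avoid t j) = (w \in avoid t j.+1) && ~~ bad w j.
  apply/avoidP/andP => [[wt av]|[/avoidP[wt av] badj]].
    split; last by apply: av; rewrite leqnn.
    by apply/avoidP; split=> // i /andP[/ltnW ji it]; apply: av; rewrite ji.
  split=> // i /andP[]; rewrite leq_eqVlt => /predU1P[/val_inj<- //|ji it].
  by apply: av; rewrite ji.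
have card_bad : j.+1 * #|[set w in avoid t j.+1 | bad w j]| <= #|avoid t j.+1|.
  have cardP : #|[pred k : 'I_#|T| | k <= j]| = j.+1.
    have inj : injective (widen_ord (ltn_ord j)) by move=> x y [] /val_inj.
    rewrite -[RHS]card_ord -(card_image inj).
    apply: eq_card => k; rewrite inE; apply/idP/imageP => [kj|[k' _ ->]].
      by exists (Ordinal (kj : k < j.+1)) => //; exact: val_inj.
    by rewrite /= -ltnS.
  rewrite -{1}cardP (swap_average (A := bad)) => [|w k /= kj|w k /= kj _].
  - rewrite -[leqRHS]muln1 -sum_nat_const; apply: leq_sum => w.
    move=> /avoidP[wt _]; rewrite -(card_imset _ (@arrival_inj _ w)).
    apply: leq_trans (card_f (arrived w j) (_ : e \in arrived w t)); last first.
      by rewrite -wt mem_arrived.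
    apply/subset_leq_card/subsetP => x /imsetP[k].
    by rewrite inE => /andP[_ ?] ->.
  - move=> /avoidP[wt av]; apply/avoidP.
    rewrite arrival_swap ?kj //=; split=> // i.
    move=> /andP[ji it]; rewrite arrival_swap ?kj //= !arrived_swap ?kj //=.
    + by apply: av; rewrite ji.
    + exact: ltnW.
    + exact: ltnW.
  - by rewrite /bad arrival_reorder tpermR !arrived_swap ?kj //= ltnW.
have -> : #|avoid t j| = #|avoid t j.+1| - #|[set w in avoid t j.+1 | bad w j]|.
  rewrite -cardsDS; last by apply/subsetP => w; rewrite inE => /andP[].
  apply: eq_card => w; rewrite avoidE in_setD inE.
  by case: (w \in _) => //=; rewrite andbT.
by rewrite mulnBr mulSn addnC -addnBA // leq_addr.
Qed.

(** The factors [j / j.+1] for [s <= j < t] telescope to [s / t], starting from the fraction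
    [1 / #|T|] of orders with [e] at time [t]. *)
Lemma card_avoid t (s : nat) : s <= t ->
  s * #|{: arrival_order T}| <= t * (#|T| * #|avoid t s|).
Proof.
move=> st; rewrite -(card_avoid_self t) mulnCA [leqRHS]mulnCA leq_mul2l.
apply/orP; right; move: st; have [m] := ubnP (t - s).
elim: m s => // m IH s tsm; rewrite leq_eqVlt => /predU1P[->//|st].
have [->|s0] := posnP s; first by rewrite mul0n.
have := card_avoidS (t := t) (j := Ordinal (ltn_trans st (ltn_ord t))) st.
rewrite /= => step_s.
rewrite -(leq_pmul2l (ltn0Sn s)) mulnCA.
apply: leq_trans (leq_mul (leqnn s) (IH s.+1 _ st)) _.
  by rewrite -ltnS (leq_trans _ tsm) // ltnS ltn_sub2l.
by rewrite mulnCA [leqRHS]mulnCA leq_mul2l step_s orbT.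
Qed.

End AvoidForbidden.
End Reorder.

(** * Binomial averages *)

From mathcomp Require Import all_classical all_reals all_analysis.

Import numFieldNormedType.Exports.

Local Open Scope ring_scope.

Section BinomialMean.
Context {R : realType}.
Implicit Types (p : R) (f : nat -> R) (n k : nat).

Definition binomial_mean n p f : R :=
  \sum_(k < n.+1) binomial_pmf n p k * f k.

Lemma binomial_pmfE n p k :
  binomial_pmf n p k = p ^+ k * (1 - p) ^+ (n - k) *+ 'C(n, k).
Proof. by []. Qed.

Lemma binomial_pmf0 n p : binomial_pmf n p 0 = (1 - p) ^+ n.
Proof. by rewrite !binomial_pmfE bin0 mulr1n expr0 mul1r subn0. Qed.

Lemma binomial_pmf_small n p k : (n < k)%N -> binomial_pmf n p k = 0.
Proof. by move=> nk; rewrite !binomial_pmfE bin_small. Qed.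

(** Pascal's rule: conditioning on the outcome of one trial. *)
Lemma binomial_pmfS n p k : binomial_pmf n.+1 p k.+1 =
  p * binomial_pmf n p k + (1 - p) * binomial_pmf n p k.+1.
Proof.
rewrite !binomial_pmfE binS mulrnDr addrC subSS exprS; congr (_ + _).
  by rewrite -mulrA mulrnAr.
(* For [n <= k] the truncated subtraction spoils the identity of powers, but the binomial
   coefficient vanishes. *)
have [nk|kn] := leqP n k; first by rewrite bin_small // !mulr0n mulr0.
by rewrite -[(n - k)%N](@prednK) ?subn_gt0 // -subnS !exprS; ring.
Qed.

Lemma mul_binomial_pmf n p k :
  k.+1%:R * binomial_pmf n.+1 p k.+1 = n.+1%:R * (p * binomial_pmf n p k).
Proof.
have binE : k.+1%:R * 'C(n.+1, k.+1)%:R = n.+1%:R * 'C(n, k)%:R :> R.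
  by rewrite -!natrM -mul_bin_diag.
rewrite !binomial_pmfE subSS exprS.
rewrite -[_ *+ 'C(n.+1, _)]mulr_natl -[_ *+ 'C(n, _)]mulr_natl.
by rewrite mulrA binE -!mulrA; congr (_ * _); rewrite mulrCA.
Qed.

Lemma binomial_meanS n p f : binomial_mean n.+1 p f =
  (1 - p) * binomial_mean n p f + p * binomial_mean n p (f \o S).
Proof.
have -> : binomial_mean n p f = \sum_(k < n.+2) binomial_pmf n p k * f k.
  by rewrite big_ord_recr /= binomial_pmf_small // mul0r addr0.
rewrite /binomial_mean big_ord_recl [in RHS]big_ord_recl /= !binomial_pmf0.
rewrite mulrDr -addrA exprS -!mulrA; congr (_ + _).
rewrite !mulr_sumr -big_split /=; apply: eq_bigr => k _.
by rewrite /bump leq0n add1n binomial_pmfS; ring.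
Qed.

Lemma eq_binomial_mean n p f g : (forall k, (k <= n)%N -> f k = g k) ->
  binomial_mean n p f = binomial_mean n p g.
Proof.
by move=> fg; apply: eq_bigr => k _; rewrite fg // -ltnS.
Qed.

Lemma binomial_meanD n p f g :
  binomial_mean n p (fun k => f k + g k) =
  binomial_mean n p f + binomial_mean n p g.
Proof. by rewrite -big_split /=; apply: eq_bigr => k _; rewrite mulrDr. Qed.

Lemma binomial_meanZ n p a f :
  binomial_mean n p (fun k => a * f k) = a * binomial_mean n p f.
Proof. by rewrite mulr_sumr; apply: eq_bigr => k _; rewrite mulrCA. Qed.

Lemma binomial_mean_cst n p a : binomial_mean n p (fun=> a) = a.
Proof.
elim: n => [|n IH].
  by rewrite /binomial_mean big_ord1 binomial_pmf0 mul1r.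
by rewrite binomial_meanS IH; ring.
Qed.

(** By [mul_binomial_pmf] each term is a binomial probability for [n.+1] trials divided by [n.+1];
    only the outcome 0 is missing from the total. *)
Lemma binomial_mean_inv n p :
  p * binomial_mean n p (fun k => k.+1%:R^-1) = (1 - (1 - p) ^+ n.+1) / n.+1%:R.
Proof.
rewrite -[X in X - _](binomial_mean_cst n.+1 p).
rewrite /binomial_mean [in RHS]big_ord_recl /= binomial_pmf0 mulr1 addrC addKr.
rewrite mulr_sumr mulr_suml; apply: eq_bigr => k _.
rewrite /bump leq0n add1n mulr1.
apply: (mulfI (x := k.+1%:R)); first by rewrite pnatr_eq0.
apply: (mulfI (x := n.+1%:R)); first by rewrite pnatr_eq0.
rewrite [X in _ = _ * X]mulrA mul_binomial_pmf mulrC.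
by field; rewrite !nat1r !pnatr_eq0.
Qed.

(** One more trial adds [1 / n.+1] to the tail of the harmonic sum and, on success, removes its
    first term [1 / j.+1]; by [binomial_mean_inv] the net gain is [(1 - p) ^+ n.+1 / n.+1]. *)
Lemma binomial_mean_harmonic n p :
  binomial_mean n p (fun j => \sum_(j.+1 <= m < n.+1) m%:R^-1) =
  \sum_(1 <= k < n.+1) (1 - p) ^+ k / k%:R.
Proof.
elim: n => [|n IH].
  by rewrite /binomial_mean big_ord1 !big_geq // mulr0.
rewrite [RHS]big_nat_recr //= -IH binomial_meanS.
rewrite (@eq_binomial_mean n p _
  (fun j => \sum_(j.+1 <= m < n.+1) m%:R^-1 + n.+1%:R^-1)); last first.
  by move=> k kn; rewrite big_nat_recr.
rewrite (@eq_binomial_mean n p (_ \o _) (fun j =>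
  (\sum_(j.+1 <= m < n.+1) m%:R^-1 + n.+1%:R^-1) + (-1) * j.+1%:R^-1));
  last first.
  move=> k kn /=; rewrite -big_nat_recr //= (big_ltn (m := k.+1)) //; ring.
rewrite !binomial_meanD binomial_meanZ binomial_mean_cst.
have -> (a b c : R) :
    (1 - p) * (a + b) + p * (a + b + -1 * c) = a + b - p * c.
  by move=> *; ring.
by rewrite binomial_mean_inv; field; rewrite nat1r pnatr_eq0.
Qed.

End BinomialMean.

(** * A truncated series bound for the logarithm *)

Section LogBound.
Context {R : realType}.
Implicit Types (x : R) (n : nat).

Lemma is_derive_exprB x n :
  is_derive x 1 (fun y : R => (1 - y) ^+ n.+1) (- (n.+1%:R * (1 - x) ^+ n)).
Proof.
have dB : is_derive x 1 (cst 1 - id : R -> R) (0 - 1) by exact: is_deriveB.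
rewrite (_ : (fun _ => _) = (cst 1 - id) ^+ n.+1); last by rewrite exprfctE.
apply: (is_derive_eq (is_deriveX n.+1 dB)).
by rewrite sub0r scalerN /GRing.scale /= mulr1.
Qed.

Lemma is_derive_log_sum x n : is_derive x 1
  (fun y : R => \sum_(1 <= k < n.+1) (1 - y) ^+ k / k%:R)
  (- \sum_(k < n) (1 - x) ^+ k).
Proof.
elim: n => [|n IH].
  rewrite big_ord0 oppr0 (_ : (fun _ => _) = cst 0); first exact: is_derive_cst.
  by apply/funext => y; rewrite big_geq.
rewrite (_ : (fun _ => _) = (fun y : R =>
  \sum_(1 <= k < n.+1) (1 - y) ^+ k / k%:R) +
  (n.+1%:R^-1 *: (fun y : R => (1 - y) ^+ n.+1))); last first.
  by apply/funext => y; rewrite big_nat_recr //= [_ / _]mulrC.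
apply: (is_derive_eq (is_deriveD IH (is_deriveZ _ (is_derive_exprB x n)))).
by rewrite big_ord_recr /= scalerN /GRing.scale /= opprD mulKf.
Qed.

(* The remainder q^(n+1) / ((n+1) x), q = 1 - x, dominates the tail of the    *)
(* series of - ln x in q; the difference of both sides has derivative         *)
(* - q^(n+1) / ((n+1) x^2) <= 0 and vanishes at x = 1.                        *)
Lemma ln_sum_bound x n : 0 < x -> x <= 1 ->
  - ln x <= \sum_(1 <= k < n.+1) (1 - x) ^+ k / k%:R +
            n.+1%:R^-1 * ((1 - x) ^+ n.+1 / x).
Proof.
move=> x0 x1.
pose g : R -> R := (fun y : R => \sum_(1 <= k < n.+1) (1 - y) ^+ k / k%:R) +
  (n.+1%:R^-1 *: ((fun y : R => (1 - y) ^+ n.+1) * (fun y : R => y^-1))) +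
  @ln R.
have dg (y : R) : 0 < y ->
    is_derive y 1 g (- ((1 - y) ^+ n.+1 / (n.+1%:R * y ^+ 2))).
  move=> y0; have y_neq0 : y != 0 by rewrite gt_eqF.
  have dV := @is_deriveV _ id y _ _ y_neq0 (is_derive_id y (1 : R)).
  apply: (is_derive_eq (is_deriveD (is_deriveD (is_derive_log_sum y n)
    (is_deriveZ _ (is_deriveM (is_derive_exprB y n) dV))) (is_derive1_ln y0))).
  have -> : \sum_(k < n) (1 - y) ^+ k = (1 - (1 - y) ^+ n) / y.
    rewrite -[1 - _ ^+ n]opprB subrX1 addrAC subrr sub0r !mulNr opprK mulrAC.
    by rewrite mulfV ?mul1r.
  rewrite /GRing.scale /= mulr1 !exprS expr0; field.
  by rewrite y_neq0 nat1r pnatr_eq0.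
have g1 : g 1 = 0.
  rewrite /g /= !fctE ln1 subrr addr0 expr0n /= mul0r scaler0 addr0.
  rewrite big_nat big1 // => k /andP[k0 _].
  by rewrite expr0n gtn_eqF // mul0r.
suff : g 1 <= g x by rewrite g1 -lerBlDr sub0r.
have pos (y : R) : x <= y -> 0 < y by exact: lt_le_trans.
apply: (@ler0_derive1_le_cc _ g x 1) => //; rewrite ?in_itv /= ?lexx ?x1 //.
- by move=> y; rewrite in_itv => /andP[/ltW/pos y0 _]; have [] := dg y y0.
- move=> y; rewrite in_itv => /andP[/ltW/pos y0 /ltW y1].
  have ? := dg y y0; rewrite derive1E derive_val oppr_le0.
  by rewrite divr_ge0 ?mulr_ge0 ?exprn_ge0 ?subr_ge0 // ltW.
- apply: derivable_within_continuous => y; rewrite in_itv => /andP[/pos y0 _].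
  by have [] := dg y y0.
Qed.

End LogBound.

(** * The competitive ratio *)

Lemma card_arrival_order_gt0 (T : finType) : (0 < #|{: arrival_order T}|)%N.
Proof.
have inj : injectiveb [ffun i : 'I_#|T| => enum_val i].
  by apply/injectiveP => i j; rewrite !ffunE => /enum_val_inj.
apply/card_gt0P.
by exists (exist (fun v : {ffun 'I_#|T| -> T} => injectiveb v) _ inj).
Qed.

Section Competitiveness.
Context {R : realType} {L : finType} {d : Order.disp_t} {T : finOrderType d}.
Variables (F : {set L * T}) (M : {set T} -> {set L * T}).

(** The binomial law is a finite combination of Dirac masses, so the two sums can be exchanged and
    the inner one counts orders. *)
Lemma PrE (p : R) (E : nat -> arrival_order T -> bool) : 0 <= p <= 1 ->
  Pr (transversal_alg F M p) E = (binomial_mean #|T| p (fun s =>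
    #|[set w | E s w]%SET|%:R / #|{: arrival_order T}|%:R))%:E.
Proof.
move=> /andP[p0 p1]; rewrite /Pr /=.
have probE (U : set nat) : binomial_prob #|T| p U =
    (\sum_(k < #|T|.+1) binomial_pmf #|T| p k * (nat_of_ord k \in U)%:R)%:E.
  rewrite (@binomial_probE _ _ _ p0 p1) -sumEFin.
  by apply: eq_bigr => k _; rewrite diracE -EFinM.
under eq_bigr do rewrite probE.
rewrite sumEFin -EFinM; congr (_%:E).
rewrite exchange_big mulr_sumr /binomial_mean; apply: eq_bigr => k _.
rewrite -mulr_sumr mulrCA [_^-1 * _]mulrC; congr (_ * (_ / _)).
rewrite -natr_sum; congr (_%:R).
rewrite -[RHS]sum1_card [RHS]big_mkcond /=.
apply: eq_bigr => w _; rewrite finset.inE.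
have -> : ((k : nat) \in [set s | E s w]%classic) = E k w.
  by apply/idP/idP => [/set_mem|kE] //; exact/mem_set.
by case: (E k w).
Qed.

(* Lower bound on the probability that a given element of OPT is selected     *)
(* when s terminals out of n are sampled: the sum over its arrival time m + 1 *)
(* of 1 / n times the product of the 1 - 1 / j, s < j <= m. This product is   *)
(* s / m, or 1 if s = m = 0.                                                  *)
Definition selection_bound (n s : nat) : R :=
  if s == 0%N then n%:R^-1 else s%:R / n%:R * \sum_(s <= m < n) m%:R^-1.

(** The factor [s / n.+1] turns the weight of [s = k.+1] among [n.+1] trials into [p] times the
    weight of [k] among [n], leaving the harmonic mean; the first summand is the case [s = 0]. *)
Lemma binomial_mean_selection_bound n (p : R) :
  binomial_mean n.+1 p (selection_bound n.+1) =
  (1 - p) ^+ n.+1 / n.+1%:R + p * \sum_(1 <= k < n.+1) (1 - p) ^+ k / k%:R.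
Proof.
rewrite /binomial_mean big_ord_recl /= binomial_pmf0 -binomial_mean_harmonic.
congr (_ + _); rewrite mulr_sumr; apply: eq_bigr => k _.
rewrite /selection_bound /bump leq0n add1n /= !mulrA; congr (_ * _).
by rewrite [_ * k.+1%:R]mulrC mul_binomial_pmf mulrC mulKf ?pnatr_eq0.
Qed.

(** The contribution of the empty sample is exactly [p] times the remainder in [ln_sum_bound], so
    the bound holds for every finite size. *)
Lemma binomial_mean_selection_bound_ge n (p : R) : 0 < p -> p <= 1 ->
  - (p * ln p) <= binomial_mean n.+1 p (selection_bound n.+1).
Proof.
move=> p0 p1; rewrite binomial_mean_selection_bound -mulrN.
apply: le_trans (ler_wpM2l (ltW p0) (ln_sum_bound n p0 p1)) _.
rewrite mulrDr addrC lerD2r [_^-1 * _]mulrC mulrA mulrCA mulfV ?mulr1 //.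
by rewrite gt_eqF.
Qed.

Hypothesis hM : canonical_matching F M.

(** The events [avoid f e t s] for [t >= s] are disjoint, since [e] arrives once, and each of them
    forces the selection of [e]. *)
Lemma card_selected (e : T) (s : nat) :
  e \in opt (transversal_indep F) [set: T] ->
  (s <= #|T|)%N ->
  #|{: arrival_order T}|%:R * selection_bound #|T| s <=
    #|[set w | e \in alg_output F M s w]%SET|%:R :> R.
Proof.
move=> eO sT; set f := fun X Y => rival F M X Y e.
have e_opt (Y : {set T}) : e \in Y -> e \in opt (transversal_indep F) Y.
  by move=> eY; apply: opt_anti eO => //; exact: subsetT.
have card_f (X Y : {set T}) : e \in Y -> (#|f X Y| <= 1)%N.
  by move=> /e_opt; exact: card_rival.
have T0 : (0 < #|T|)%N by apply/card_gt0P; exists e.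
have : (\sum_(t < #|T| | s <= t) #|avoid f e t s| <=
        #|[set w | e \in alg_output F M s w]%SET|)%N.
  have card_sum (A : {set arrival_order T}) :
      #|A| = (\sum_w if w \in A then 1 else 0)%N.
    by rewrite -sum1_card big_mkcond.
  rewrite card_sum (eq_bigr _ (fun t _ => card_sum (avoid f e t s))).
  rewrite exchange_big /=; apply: leq_sum => w _.
  have [i wi] := arrival_surj w e.
  rewrite big_mkcond (bigD1 i) //= big1 ?addn0 => [|j ji]; last first.
    case: ifP => // _; case: ifP => // /avoidP[wj _].
    by move: ji; rewrite -(inj_eq (@arrival_inj _ w)) wi wj eqxx.
  case: ifP => // si; case: ifP => // /avoidP[_ av].
  rewrite inE -wi rival_forbidden // wi //.
  by rewrite e_opt // -wi mem_arrived.
rewrite -(ler_nat R); apply: le_trans; rewrite /selection_bound.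
(* For [s = 0] the bound of [card_avoid] is void; the orders in which [e] arrives first already give
   the fraction [1 / #|T|]. *)
have [s0|s0] := posnP s.
  rewrite s0 ler_pdivrMr ?ltr0n // -natrM ler_nat.
  rewrite (bigD1 (Ordinal T0)) //= -(card_avoid_self f e (Ordinal T0)) mulnC.
  by rewrite leq_mul2r leq_addr orbT.
rewrite big_geq_mkord /= natr_sum !mulr_sumr; apply: ler_sum => t st.
have t0 : 0 < t%:R :> R by rewrite ltr0n (leq_trans s0).
rewrite mulrA ler_pdivrMr // mulrA ler_pdivrMr ?ltr0n // -!natrM ler_nat.
rewrite mulnC [leqRHS]mulnAC [leqRHS]mulnC [(_ * #|T|)%N]mulnC.
exact: card_avoid.
Qed.

Lemma selection_probability_ge (p : R) e : 0 < p -> p <= 1 ->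
  e \in opt (transversal_indep F) [set: T] ->
  ((- (p * ln p))%:E <=
    Pr (transversal_alg F M p) (fun s w => e \in alg_output F M s w))%E.
Proof.
move=> p0 p1 eO; have p01 : 0 <= p <= 1 by rewrite p1 ltW.
rewrite PrE // lee_fin.
have T0 : (0 < #|T|)%N by apply/card_gt0P; exists e.
have := binomial_mean_selection_bound_ge #|T|.-1 p0 p1.
rewrite prednK // => /le_trans; apply; apply: ler_sum => k _.
rewrite ler_wpM2l ?binomial_pmf_ge0 //.
rewrite ler_pdivlMr ?ltr0n ?card_arrival_order_gt0 //.
by rewrite mulrC card_selected // -ltnS.
Qed.

End Competitiveness.

Theorem theorem4 (R : realType) (L : finType) (d : Order.disp_t)
    (T : finOrderType d) (F : {set L * T}) (M : {set T} -> {set L * T})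
    (hM : canonical_matching F M) :
  (forall p : R, 0 <= p <= 1 ->
     has_forbidden_sets (transversal_indep F) p 1 (transversal_alg F M p)) /\
  prob_competitive (transversal_indep F) (expR 1 : R)
    (transversal_alg F M (expR 1 : R)^-1).
Proof.
split=> [p _|e eO].
  split.
  - by move=> s w _; exact: alg_output_indep.
  - by split=> // s w _; exact: alg_output_sample.
  - exists (rival F M); split=> [X Y r rO _|s w t _]; last exact: rival_forbidden.
    by rewrite rival_sub card_rival.
have e0 : 0 < expR 1 :> R by exact: expR_gt0.
have := @selection_probability_ge R L d T F M hM (expR 1)^-1 e.
(* At [p = 1 / e] the logarithm is [-1], so [- (p * ln p)] is [p] itself, the inverse of the claimed
   ratio. *)
rewrite lnV ?posrE // expRK mulrN1 opprK; apply => //.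
by rewrite invf_le1 // -expR0 ler_expR.
Qed.
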